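(* Let $X=Y=\mathbf{R}$ and let $\mathcal{I},\mathcal{J}$ be ideals on $\omega$ such that $\mathcal{J}$ is countably generated. Let $\mathscr{A}=\{A^\nu:\nu<\kappa\}$ be a nonempty family of infinite real matrices $A^\nu=(a^\nu_{n,k}:n,k\in\omega)$. Then $\mathscr{A}$ is $(\mathcal{I},\mathcal{J})$-regular with respect to the identity operator $I$ on $\mathbf{R}$ if and only if all of the following hold: (M1) $\sup_n\sum_k|a^\nu_{n,k}|<\infty$ for each $\nu$; (M2) $\sup_\nu\sup_{n\in J}\sum_k|a^\nu_{n,k}|<\infty$ for some $J\in\mathcal{J}^\star$; (M3) $\mathcal{J}\text{-}\lim_n\sum_ka^\nu_{n,k}=1$ uniformly on $\nu$; (M4) $\mathcal{J}\text{-}\lim_n\sum_{k\in E}a^\nu_{n,k}=0$ uniformly on $\nu$, for all $E\in\mathcal{I}$.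
   Context: $\omega=\{0,1,2,\ldots\}$. The index $\nu$ ranges over all $\nu<\kappa$, where $\kappa=|\mathscr{A}|$ is an arbitrary nonzero cardinal. An ideal on $\omega$ is a family $\mathcal{I}$ of subsets of $\omega$ closed under finite unions and subsets; it is always assumed that $\omega\notin\mathcal{I}$ and that $\mathcal{I}$ contains all finite subsets of $\omega$. $\mathcal{I}^\star:=\{\omega\setminus S:S\in\mathcal{I}\}$. $\mathcal{I}$ is countably generated if there is a sequence $(S_n)_{n\in\omega}$ in $\mathcal{I}$ such that for all $S\subseteq\omega$: $S\in\mathcal{I}$ iff $S\subseteq\bigcup_{n\in F}S_n$ for some finite $F\subseteq\omega$. A real sequence $(x_n)$ is $\mathcal{I}$-convergent to $\eta$ ($\mathcal{I}\text{-}\lim\bm{x}=\eta$) if $\{n:x_n\notin U\}\in\mathcal{I}$ for every neighborhood $U$ of $\eta$. A statement ''$\mathcal{J}\text{-}\lim_ny^\nu_n=\eta$ uniformly on $\nu$'' means: for every neighborhood $U$ of $\eta$ there is $S\in\mathcal{J}^\star$ with $y^\nu_n\in U$ for all $n\in S$ and all $\nu<\kappa$. For a real matrix $A=(a_{n,k})$, $\mathrm{dom}(A)$ is the set of real sequences $\bm{x}=(x_k)$ such that $\sum_ka_{n,k}x_k$ converges for every $n$; then $A_n\bm{x}:=\sum_ka_{n,k}x_k$ and $A\bm{x}:=(A_n\bm{x}:n\in\omega)$. $c^b(\mathbf{R},\mathcal{I})$ is the space of bounded $\mathcal{I}$-convergent real sequences. $\mathscr{A}$ is $(\mathcal{I},\mathcal{J})$-regular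 with respect to $I$ if, for every $\nu$, $c^b(\mathbf{R},\mathcal{I})\subseteq\mathrm{dom}(A^\nu)$ and $A^\nu\bm{x}\in c^b(\mathbf{R},\mathcal{J})$ for all $\bm{x}\in c^b(\mathbf{R},\mathcal{I})$, and moreover, for all $\bm{x}\in c^b(\mathbf{R},\mathcal{I})$, $\mathcal{J}\text{-}\lim A^\nu\bm{x}=\mathcal{I}\text{-}\lim\bm{x}$ uniformly on $\nu$. *)

(* Defs.v *)
From HB Require Import structures.
From mathcomp Require Import all_boot all_order all_algebra.
From mathcomp Require Import all_classical all_reals all_analysis.

Set Implicit Arguments.
Unset Strict Implicit.
Unset Printing Implicit Defensive.

Import Order.TTheory GRing.Theory Num.Theory.
Import numFieldNormedType.Exports.

Local Open Scope classical_set_scope.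
Local Open Scope ring_scope.

Record is_ideal (I : set (set nat)) : Prop := IsIdeal {
  ideal_subset : forall S T : set nat, S `<=` T -> I T -> I S ;
  ideal_setU : forall S T : set nat, I S -> I T -> I (S `|` T) ;
  ideal_proper : ~ I [set: nat] ;
  ideal_finite : forall S : set nat, finite_set S -> I S }.

Definition dual_filter (I : set (set nat)) : set (set nat) :=
  [set ~` S | S in I].

Definition countably_generated (I : set (set nat)) : Prop :=
  exists S_ : nat -> set nat,
    (forall n, I (S_ n)) /\
    (forall S : set nat,
       I S <-> exists2 F : set nat, finite_set F & S `<=` \bigcup_(n in F) S_ n).

Section IdealConvergence.
Variable R : realType.

Definition ideal_cvg (I : set (set nat)) (x : nat -> R) (eta : R) : Prop :=
  forall U : set R, nbhs eta U -> I [set n | ~ U (x n)].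

Definition unif_ideal_cvg (J : set (set nat)) (K : Type)
    (y : K -> nat -> R) (eta : R) : Prop :=
  forall U : set R, nbhs eta U ->
    exists2 S : set nat, dual_filter J S &
      forall n, S n -> forall nu : K, U (y nu n).

Definition bounded_ideal_cvg (I : set (set nat)) : set (nat -> R) :=
  [set x | bounded_fun x /\ exists eta, ideal_cvg I x eta].

Definition mx_dom (A : nat -> nat -> R) : set (nat -> R) :=
  [set x | forall n, cvgn (series (fun k => A n k * x k))].

(* Meaningful only for x in mx_dom A: otherwise the limits are unspecified. *)
Definition mx_transform (A : nat -> nat -> R) (x : nat -> R) : nat -> R :=
  fun n => limn (series (fun k => A n k * x k)).

(* The family A = (A^nu) is (I, J)-regular with respect to the identity operator
   on R.  As I is a proper ideal, the I-limit eta of x is unique. *)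
Definition regular_wrt_id (I J : set (set nat)) (K : Type)
    (A : K -> nat -> nat -> R) : Prop :=
  (forall nu : K,
     bounded_ideal_cvg I `<=` mx_dom (A nu) /\
     (forall x, bounded_ideal_cvg I x ->
        bounded_ideal_cvg J (mx_transform (A nu) x))) /\
  (forall x, bounded_ideal_cvg I x -> forall eta, ideal_cvg I x eta ->
     unif_ideal_cvg J (fun nu => mx_transform (A nu) x) eta).

Definition row_abs_sum (A : nat -> nat -> R) (n : nat) : \bar R :=
  (\sum_(0 <= k <oo) `|A n k|%:E)%E.

End IdealConvergence.

(* Main.v *)
Require Import Defs.
From mathcomp Require Import all_boot all_order all_algebra.
From mathcomp Require Import all_classical all_reals all_analysis.
From mathcomp Require Import ring lra.

(** Necessity.  Every null sequence is bounded and I-convergent to 0, so the rows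
    of the A^nu are functionals on c_0 and (M1) is uniform boundedness.  For (M2),
    if no set of the dual filter of J worked, countable generation of J would
    give a sequence of rows, eventually outside each set of J, with unbounded
    l1-norms, although regularity makes it tend to 0 pointwise on c_0.  (M3) and
    (M4) are regularity tested on 1 and on the indicators of sets of I.

    Sufficiency.  By (M3) it suffices to treat bounded x with I-limit 0.  Up to
    an arbitrarily small uniform error, controlled by (M2), such an x is a linear
    combination of indicators of sets of I, to which (M4) applies. *)

Set Implicit Arguments.
Unset Strict Implicit.
Unset Printing Implicit Defensive.

Import Order.TTheory GRing.Theory Num.Theory.
Import numFieldNormedType.Exports.
Local Open Scope classical_set_scope.
Local Open Scope ring_scope.

(** * Pairing a summable row with a bounded sequence *)

(** The l1-norm is bounded through partial sums, so that summability of the row needs no separate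
    hypothesis. *)
Definition l1_le {R : realType} (b : nat -> R) (M : R) : Prop :=
  forall n, \sum_(0 <= k < n) `|b k| <= M.

(** The row [b] as a functional; [mx_transform A x n] unfolds to [pairing (A n) x]. *)
Definition pairing {R : realType} (b x : nat -> R) : R :=
  limn (series (fun k => b k * x k)).

Lemma l1_le_cvg {R : realType} (b x : nat -> R) (M B : R) :
  l1_le b M -> (forall k, `|x k| <= B) -> cvgn (series (fun k => b k * x k)).
Proof.
move=> bM xB; have B0 : 0 <= B by exact: le_trans (xB 0%N).
apply: normed_cvg; apply: nondecreasing_is_cvgn.
  by apply/nondecreasing_series => n _ _ /=; exact: normr_ge0.
exists (M * B) => _ [n _ <-].
rewrite /series /=; apply: (@le_trans _ _ (\sum_(0 <= k < n) `|b k| * B)).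
  by apply: ler_sum => k _; rewrite normrM ler_wpM2l.
by rewrite -mulr_suml ler_wpM2r.
Qed.

Lemma l1_le_pairing {R : realType} (b x : nat -> R) (M B : R) :
  l1_le b M -> (forall k, `|x k| <= B) -> `|pairing b x| <= M * B.
Proof.
move=> bM xB; have B0 : 0 <= B by exact: le_trans (xB 0%N).
have xcvg := l1_le_cvg bM xB.
have le_part n : `|series (fun k => b k * x k) n| <= M * B.
  apply: le_trans (ler_norm_sum _ _ _) _.
  apply: (@le_trans _ _ (\sum_(0 <= k < n) `|b k| * B)).
    by apply: ler_sum => k _; rewrite normrM ler_wpM2l.
  by rewrite -mulr_suml ler_wpM2r.
rewrite ler_norml; apply/andP; split.
  apply: limr_ge => //; apply: nearW => n.
  by have := le_part n; rewrite ler_norml => /andP[].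
apply: limr_le => //; apply: nearW => n.
by have := le_part n; rewrite ler_norml => /andP[].
Qed.

Lemma pairing_lin {R : realType} (b x y : nat -> R) (M B C a : R) :
  l1_le b M -> (forall k, `|x k| <= B) -> (forall k, `|y k| <= C) ->
  pairing b (fun k => x k + a * y k) = pairing b x + a * pairing b y.
Proof.
move=> bM xB yC.
have xcvg := l1_le_cvg bM xB; have ycvg := l1_le_cvg bM yC.
rewrite /pairing -[a * _](lim_seriesZ a ycvg) -lim_seriesD //; last first.
  exact: is_cvg_seriesZ.
congr (limn (series _)); apply/funext => k.
by rewrite !fctE /GRing.scale/=; ring.
Qed.

(** The series is eventually constant. Since only the product has to vanish, either the row or the
    sequence may be the one that is cut off. *)
Lemma pairing_finite {R : realType} (b x : nat -> R) (L : nat) :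
  (forall k, (L <= k)%N -> b k * x k = 0) ->
  pairing b x = \sum_(0 <= k < L) b k * x k.
Proof.
move=> x0; apply/(@lim_near_cst R) => //.
near=> n; rewrite /series /= (@big_cat_nat _ _ _ L) //=.
  have -> : \sum_(L <= k < n) b k * x k = 0.
    by rewrite big_nat big1 // => k /andP[/x0].
  by rewrite addr0.
by near: n; exact: nbhs_infty_ge.
Unshelve. all: by end_near. Qed.

(** * Uniform boundedness on c_0 *)

(** [N] is the l1-norm itself, the supremum of the partial sums. It is positive because [C] is
    nonnegative, so some partial sum exceeds half of it. *)
Lemma near_l1_norm {R : realType} (b : nat -> R) (M C : R) (n : nat) :
  l1_le b M -> 0 <= C -> C < \sum_(0 <= k < n) `|b k| ->
  exists N L, [/\ l1_le b N, C < N & N / 2 < \sum_(0 <= k < L) `|b k|].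
Proof.
move=> bM C0 Cn; set S := range (fun n => \sum_(0 <= k < n) `|b k|).
have supS : has_sup S.
  by split; [exists (\sum_(0 <= k < n) `|b k|), n | exists M => _ [m _ <-]].
have bS m : \sum_(0 <= k < m) `|b k| <= sup S.
  by apply: ub_le_sup; [case: supS | exists m].
have CS : C < sup S by exact: lt_le_trans (bS n).
have [|_ [L _ <-] SL] := @sup_adherent _ _ (sup S / 2) _ supS; first by lra.
by exists (sup S), L; split => //; lra.
Qed.

(* One of x + h and x - h always satisfies the bound, since their difference is
   2h; keeping the good one at every step produces the sequence. *)
Lemma sign_choice {R : realType} (f : nat -> (nat -> R) -> R)
    (h : nat -> nat -> R) :
  exists xs : nat -> nat -> R,
    xs 0%N = (fun=> 0) /\ forall j, exists2 a : R, `|a| = 1 &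
      xs j.+1 = (fun k => xs j k + a * h j k) /\
      (f j (fun k => xs j k + 1 * h j k) = f j (xs j) + 1 * f j (h j) ->
       f j (fun k => xs j k + -1 * h j k) = f j (xs j) + -1 * f j (h j) ->
      `|f j (h j)| <= `|f j (xs j.+1)|).
Proof.
pose a j (x : nat -> R) : R :=
  if `|f j (h j)| <= `|f j x + f j (h j)| then 1 else -1.
pose xs := fix xs (j : nat) : nat -> R := if j is i.+1 then
  (fun k => xs i k + a i (xs i) * h i k) else (fun=> 0).
exists xs; split=> // j; exists (a j (xs j)).
  by rewrite /a; case: ifP => _; rewrite ?normrN normr1.
split=> // e1 e2; rewrite /= {1}/a.
case: ifPn => [|]; first by rewrite e1 mul1r.
rewrite e2 -ltNge mulN1r; set u := f j (xs j); set v := f j (h j) => uv.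
have := ler_normB (u + v) (u - v).
rewrite (_ : u + v - (u - v) = 2 * v); last by ring.
by rewrite normrM ger0_norm //; lra.
Qed.

(* Sokal's form of the gliding hump. *)
Lemma c0_uniform_boundedness {R : realType} (b : nat -> nat -> R) :
  (forall m, exists M, l1_le (b m) M) ->
  (forall x : nat -> R, x @ \oo --> 0 ->
     exists C : R, forall m, `|pairing (b m) x| <= C) ->
  exists M, forall m, l1_le (b m) M.
Proof.
move=> bl1 bbd; apply: contrapT => nobound.
pose q (j : nat) : R := 4^-1 ^+ j.
have q0 j : 0 < q j by rewrite exprn_gt0 // invr_gt0.
(* Along row [j], of norm [N], hump [j] will contribute more than [N * q j / 2] and all later humps
   together at most [N * q j / 3]. The difference is [N * q j / 6], whence the factor 6. *)
have big_row j : exists u : nat * R * nat,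
    [/\ l1_le (b u.1.1) u.1.2, 6 * j%:R / q j < u.1.2 &
      u.1.2 / 2 < \sum_(0 <= k < u.2) `|b u.1.1 k|].
  have [m [n mn]] : exists m n,
      6 * j%:R / q j < \sum_(0 <= k < n) `|b m k|.
    apply: contrapT => H; apply: nobound; exists (6 * j%:R / q j) => m n.
    by rewrite leNgt; apply/negP => mn; apply: H; exists m, n.
  have [M bM] := bl1 m.
  have [|N [L [? ? ?]]] := near_l1_norm bM _ mn.
    by rewrite divr_ge0 // ?mulr_ge0 // ltW.
  by exists (m, N, L).
have {big_row}[u uP] := choice big_row.
pose row j := b (u j).1.1; pose N j := (u j).1.2; pose L j := (u j).2.
have rowN j : l1_le (row j) (N j) by case: (uP j).
have Nbig j : 6 * j%:R / q j < N j by case: (uP j).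
have rowL j : N j / 2 < \sum_(0 <= k < L j) `|row j k| by case: (uP j).
(* Hump [j] is the sign pattern of its row, cut at [L j] and scaled to height [q j]; its pairing
   with the row is [q j] times a partial l1-norm. *)
pose h j k := q j * (if (k < L j)%N then Num.sg (row j k) else 0).
have h_le j k : `|h j k| <= q j.
  rewrite /h normrM gtr0_norm // ler_piMr ?(ltW (q0 j)) //.
  by case: ifP => _; rewrite ?normr0 // normr_sg; case: (_ == _).
have h_supp j k : (L j <= k)%N -> h j k = 0.
  by move=> Lk; rewrite /h ltnNge Lk mulr0.
have f_h j : pairing (row j) (h j) = q j * \sum_(0 <= k < L j) `|row j k|.
  rewrite (@pairing_finite _ _ _ (L j)) => [|k Lk].
    rewrite mulr_sumr; apply: eq_big_nat => k /andP[_ kL].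
    by rewrite /h kL mulrCA [_ * Num.sg _]mulrC -normrEsg.
  by rewrite h_supp ?mulr0.
have [xs [xs0 xsS]] := sign_choice (fun j => pairing (row j)) h.
(* The sum of all [q i] with [i >= j], hence a bound for everything added from step [j] on. *)
pose r (j : nat) : R := 4 / 3 * q j.
have qS j : q j.+1 = q j / 4 by rewrite /q exprS mulrC.
have r0 j : 0 < r j by rewrite /r; have := q0 j; lra.
have xs_le i p k : `|xs (i + p)%N k - xs i k| <= r i - r (i + p)%N.
  elim: p => [|p IH]; first by rewrite addn0 !subrr normr0.
  rewrite addnS; have [a a1 [-> _]] := xsS (i + p)%N.
  have step : `|xs (i + p)%N k + a * h (i + p)%N k - xs i k| <=
      `|xs (i + p)%N k - xs i k| + q (i + p)%N.
    rewrite addrAC; apply: le_trans (ler_normD _ _) _.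
    by rewrite normrM a1 mul1r lerD2l.
  move: step IH => /le_trans + IH; apply; move: IH; rewrite /r qS.
  by set A := `|_|; set X := q _; set Y := q _; lra.
have xs_near i j k : xs i k - r i <= xs j k + r j.
  have := r0 i; have := r0 j.
  case: (leqP i j) => [/subnKC <-|/ltnW/subnKC <-]; [
    have := xs_le i (j - i)%N k|have := xs_le j (i - j)%N k];
    rewrite ler_norml => /andP[]; lra.
(* By [xs_near], each left endpoint [xs i k - r i] is below each right endpoint [xs j k + r j]; the
   supremum of the left endpoints therefore lies in all these intervals, which makes it the limit of
   [xs j k]. *)
pose x k := sup (range (fun j => xs j k - r j)).
have x_near j k : `|x k - xs j k| <= r j.
  have : xs j k - r j <= x k.
    by apply: ub_le_sup; [exists (xs 0%N k + r 0%N) => _ [i _ <-] | exists j].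
  have : x k <= xs j k + r j.
    by apply: ge_sup; [exists (xs 0%N k - r 0%N), 0%N | move=> _ [i _ <-]].
  by move=> ? ?; rewrite ler_norml; apply/andP; split; lra.
have xs_supp j : exists n, forall k, (n <= k)%N -> xs j k = 0.
  elim: j => [|j [n IH]]; first by exists 0%N => k _; rewrite xs0.
  exists (maxn n (L j)) => k; rewrite geq_max => /andP[nk Lk].
  by have [a _ [-> _]] := xsS j; rewrite IH // h_supp // mulr0 addr0.
have xs_bd j k : `|xs j k| <= r 0%N.
  have := xs_le 0%N j k; rewrite xs0 subr0 add0n => /le_trans; apply.
  by have := r0 j; lra.
have q_cvg : q @ \oo --> 0.
  have := @cvg_geometric R 1 4^-1; rewrite /geometric /= => H.
  rewrite (_ : q = (fun n => 1 * 4^-1 ^+ n)); last first.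
    by apply/funext => j; rewrite mul1r.
  by apply: H; rewrite ger0_norm ?invr_ge0 // invf_lt1 // ltr1n.
(* [x] is a uniform limit of the finitely supported [xs j]. *)
have x_cvg : x @ \oo --> 0.
  apply/cvgr0Pnorm_lt => e e0.
  have [j qj] : exists j, q j < e / 2.
    have /cvgr0Pnorm_lt /(_ (e / 2)) := q_cvg.
    case=> [|j _ /(_ j (leqnn j))]; first by lra.
    by rewrite /= gtr0_norm //; exists j.
  have [n xsn] := xs_supp j.
  exists n => // k /= nk; have := x_near j k; rewrite xsn // subr0.
  by move=> /le_lt_trans; apply; rewrite /r; lra.
have [C xC] := bbd _ x_cvg.
pose j := Num.bound `|C|.
have Cj : C < j%:R.
  by apply: le_lt_trans (ler_norm _) _; rewrite archi_boundP.
have [a a1 [xsE]] := xsS j.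
have h_bd := h_le j.
(* Linearity turns both additivity premises from [sign_choice] into reflexive equalities. *)
rewrite !(pairing_lin _ (rowN j) (xs_bd j) h_bd) => /(_ erefl erefl).
have tail : `|pairing (row j) x - pairing (row j) (xs j.+1)| <= N j * r j.+1.
  rewrite -[- _]mulN1r -(@pairing_lin _ _ _ _ (N j) (r 0%N + r 0%N) (r 0%N)) //.
    by apply: l1_le_pairing => // k; rewrite mulN1r.
  move=> k; rewrite -[x k](subrK (xs 0%N k)).
  apply: le_trans (ler_normD _ _) _; exact: lerD.
have Nj : 6 * j%:R < N j * q j by rewrite -ltr_pdivrMr.
have row_big : q j * (N j / 2) < q j * \sum_(0 <= k < L j) `|row j k|.
  by rewrite ltr_pM2l.
rewrite f_h normrM gtr0_norm // ger0_norm ?sumr_ge0 // => fxs.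
(* The triangle inequality gives [N j * q j / 2 < C + N j * q j / 3], so [N j * q j < 6 * C],
   against [6 * j < N j * q j] and [C < j]. *)
have := ler_normB (pairing (row j) x)
  (pairing (row j) x - pairing (row j) (xs j.+1)).
rewrite opprB addrCA subrr addr0.
move: tail fxs row_big (xC (u j).1.1); rewrite /r qS -/(row j).
set D := `|_ - _|; set S := \sum_(_ <= _ < _) _.
set A := `|pairing _ (xs _)|; set B := `|_| => tail fxs row_big fx tri.
rewrite (_ : N j * _ = (N j * q j) / 3) in tail; last by field.
rewrite (_ : q j * (N j / 2) = (N j * q j) / 2) in row_big; last by ring.
by clear - Cj Nj tail fxs row_big fx tri; lra.
Qed.

(** * Bounded sequences and row norms *)

Lemma bounded_seqP {R : realType} (x : nat -> R) :
  bounded_fun x <-> exists B, forall k, `|x k| <= B.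
Proof.
have globT : ProperFilter (globally [set: nat]).
  exact: globally_properfilter 0%N _.
have xP := @ex_bound _ _ _ x _ globT.
split=> [/xP[B /= xB]|[B xB]]; first by exists B => k; exact: xB.
by apply/xP; exists B => k _; exact: xB.
Qed.

(** The truncations of [b] pair with [x] to the partial sums of a convergent series, which are
    bounded; uniform boundedness then bounds the norms of all truncations at once. *)
Lemma l1_le_of_c0_cvg {R : realType} (b : nat -> R) :
  (forall x : nat -> R, x @ \oo --> 0 ->
     cvgn (series (fun k => b k * x k))) ->
  exists M, l1_le b M.
Proof.
move=> bcvg; pose trunc N k := if (k < N)%N then b k else 0.
have truncE N k : (N <= k)%N -> trunc N k = 0 by rewrite /trunc ltnNge => ->.
have [||M truncM] := @c0_uniform_boundedness R trunc.
- move=> N; exists (\sum_(0 <= k < N) `|b k|) => n.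
  (* Extending the range to [n + N] allows a split at [N] whichever of the two is larger. *)
  apply: (@le_trans _ _ (\sum_(0 <= k < n + N) `|trunc N k|)).
    by rewrite [leRHS](@big_cat_nat _ _ _ n) ?leq_addr //= lerDl sumr_ge0.
  rewrite (@big_cat_nat _ _ _ N) ?leq_addl //=.
  have -> : \sum_(N <= k < n + N) `|trunc N k| = 0.
    by rewrite big_nat big1 // => k /andP[/truncE -> _]; rewrite normr0.
  rewrite addr0; apply: ler_sum => k _.
  by rewrite /trunc; case: ifP; rewrite ?normr0.
- move=> x x0.
  have [C /= xC] := (bounded_seqP _).1 (cvg_seq_bounded (bcvg x x0)).
  exists C => N; rewrite (@pairing_finite _ _ _ N) => [|k /truncE ->]; last first.
    by rewrite mul0r.
  have -> : \sum_(0 <= k < N) trunc N k * x k = series (fun k => b k * x k) N.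
    by apply: eq_big_nat => k /andP[_ kN]; rewrite /trunc kN.
  exact: xC.
exists M => n; apply: le_trans (truncM n n).
rewrite le_eqVlt; apply/orP; left; apply/eqP.
by apply: eq_big_nat => k /andP[_ kn]; rewrite /trunc kn.
Qed.

Lemma row_abs_sum_le {R : realType} (A : nat -> nat -> R) (n : nat) (M : R) :
  (row_abs_sum A n <= M%:E)%E <-> l1_le (A n) M.
Proof.
split=> [AM m|AM].
  rewrite -lee_fin -sumEFin; apply: le_trans AM.
  by apply: nneseries_lim_ge => k _ _; rewrite lee_fin.
apply: lime_le; first by apply: is_cvg_nneseries => k _ _; rewrite lee_fin.
by apply: nearW => m; rewrite sumEFin lee_fin.
Qed.

Lemma ereal_sup_ltyP {R : realType} (S : set \bar R) :
  (ereal_sup S < +oo)%E <-> exists M : R, forall y, S y -> (y <= M%:E)%E.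
Proof.
split=> [|[M SM]]; last by apply: le_lt_trans (ltry M); exact: ge_ereal_sup.
have := @ereal_sup_ubound R S.
case: (ereal_sup S) => [r| |] //= ubS _; first by exists r => y /ubS.
(* The supremum is [-oo], as for empty [S], and any real number is a bound. *)
by exists 0 => y /ubS /le_trans; apply; exact: leNye.
Qed.

(** * Ideals as filters *)

(** The sets of [dual_filter I], described by their complements so that membership unfolds directly
    to [I]. *)
Definition ideal_filter (I : set (set nat)) : set_system nat :=
  [set S | I (~` S)].

Lemma ideal_filter_filter (I : set (set nat)) :
  is_ideal I -> Filter (ideal_filter I).
Proof.
case=> sub U _ fin; split.
- by rewrite /ideal_filter /= setCT; exact: fin.
- by move=> P Q IP IQ; rewrite /ideal_filter /= setCI; exact: U.
- by move=> P Q PQ; apply: sub; exact: subsetC.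
Qed.

(** Cofinite sets belong to the dual filter, so ordinary convergence implies convergence along the
    ideal. *)
Lemma ideal_filter_oo (I : set (set nat)) :
  is_ideal I -> ideal_filter I `=>` \oo.
Proof.
move=> hI P [N _ NP]; apply: ideal_finite hI _ _.
apply: (@sub_finite_set _ _ `I_N) (finite_II N) => n /= nP.
by rewrite ltnNge; apply/negP => /NP.
Qed.

Lemma ideal_cvgP {R : realType} (I : set (set nat)) (x : nat -> R) (eta : R) :
  ideal_cvg I x eta <-> x @ ideal_filter I --> eta.
Proof. by split=> xI U /xI. Qed.

(** Uniformity is kept by quantifying over [nu] inside the filter statement: one set of the filter
    serves all [nu]. *)
Lemma unif_ideal_cvgP {R : realType} (J : set (set nat)) (K : Type)
    (y : K -> nat -> R) (eta : R) : is_ideal J ->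
  unif_ideal_cvg J y eta <-> forall e, 0 < e ->
    \forall n \near ideal_filter J, forall nu, `|y nu n - eta| < e.
Proof.
move=> hJ; have FJ := ideal_filter_filter hJ; split=> [yJ e e0|yJ U].
  have [_ [S JS <-] yS] := yJ _ (nbhsx_ballx eta e e0).
  apply: (@filterS _ _ FJ (~` S)); last by rewrite /ideal_filter /= setCK.
  by move=> n Sn nu; rewrite distrC; exact: yS.
move=> /nbhs_ballP[e /= e0 eU].
exists [set n | forall nu, `|y nu n - eta| < e].
  by eexists; [exact: yJ e e0 | rewrite setCK].
by move=> n yn nu; apply: eU; rewrite /ball/= distrC.
Qed.

Lemma c0_bounded_ideal_cvg {R : realType} (I : set (set nat)) (x : nat -> R) :
  is_ideal I -> x @ \oo --> 0 -> bounded_ideal_cvg I x /\ ideal_cvg I x 0.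
Proof.
move=> hI x0; have xI : ideal_cvg I x 0.
  by move=> U /x0; exact: ideal_filter_oo hI _.
by split=> //; split; [apply: cvg_seq_bounded; apply/cvg_ex; exists 0 | exists 0].
Qed.

(** * A common row bound from countable generation *)

Lemma near_l1_le {R : realType} (J : set (set nat)) (K : Type)
    (A : K -> nat -> nat -> R) :
  is_ideal J -> countably_generated J ->
  (forall nu n, exists M, l1_le (A nu n) M) ->
  (forall x : nat -> R, x @ \oo --> 0 ->
     \forall n \near ideal_filter J, forall nu, `|pairing (A nu n) x| <= 1) ->
  exists M, \forall n \near ideal_filter J, forall nu, l1_le (A nu n) M.
Proof.
move=> hJ [S [_ JS]] Al1 Abd; apply: contrapT => nobound.
(* The [m]-th chosen row has its index outside the first [m] generators and its norm not bounded by
   [m]. *)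
pose T m := \bigcup_(n in `I_m) S n.
have JT m : J (T m) by apply/JS; exists `I_m.
have bad m : exists u : K * nat, ~ T m u.2 /\ ~ l1_le (A u.1 u.2) m%:R.
  apply: contrapT => H; apply: nobound; exists m%:R.
  apply: (ideal_subset hJ) (JT m) => n /= /existsNP[nu nuM].
  by apply: contrapT => nT; apply: H; exists (nu, n).
have {bad}[u uP] := choice bad.
have [||M bM] := @c0_uniform_boundedness R (fun m => A (u m).1 (u m).2).
- by move=> m; exact: Al1.
(* The indices at which the bound 1 fails for [x] are covered by finitely many generators, all
   numbered below some [N]. Chosen rows from [N] on avoid them; the first [N] rows are bounded by
   finiteness. *)
- move=> x x0; have /JS[F finF FS] := Abd x x0.
  have [N FN] : exists N, F `<=` `I_N.
    have [s ->] := (finite_seqP F).1 finF.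
    exists (\max_(i <- s) i).+1 => i /= si; rewrite ltnS.
    exact: (leq_bigmax_seq (F := id)).
  pose f m := `|pairing (A (u m).1 (u m).2) x|.
  have [C fC] : exists C, forall m, (m < N)%N -> f m <= C.
    elim: {FN}N => [|N [C fC]]; first by exists 0.
    exists (Num.max C (f N)) => m; rewrite ltnS leq_eqVlt le_max.
    by move=> /orP[/eqP ->|/fC -> //]; rewrite lexx orbT.
  exists (Num.max C 1) => m; rewrite le_max.
  have [/fC -> //|Nm] := ltnP m N; apply/orP; right.
  apply: contrapT => xm; have [nT _] := uP m; apply: nT.
  have [i Fi Si] : (\bigcup_(n in F) S n) (u m).2.
    by apply: FS => /= /(_ (u m).1).
  by exists i => //=; exact: leq_trans (FN _ Fi) Nm.
have [_] := uP (Num.bound `|M|); apply => n.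
apply: le_trans (bM _ _) _; apply: le_trans (ler_norm _) _.
by rewrite ltW // archi_boundP.
Qed.

(** * Sequences with limit 0 along the ideal *)

(* Subtracting from z the step function with values +-B/2 on the sets where
   |z| > B/2 halves the bound, at the cost of two indicators of sets of I. *)
Lemma near_pairing_null {R : realType} (I J : set (set nat)) (K : Type)
    (A : K -> nat -> nat -> R) (M : R) : is_ideal I -> is_ideal J ->
  (\forall n \near ideal_filter J, forall nu, l1_le (A nu n) M) ->
  (forall E, I E -> forall e, 0 < e ->
     \forall n \near ideal_filter J, forall nu, `|pairing (A nu n) \1_E| < e) ->
  forall (p : nat) (z : nat -> R) (B : R), z @ ideal_filter I --> 0 ->
  0 < B -> (forall k, `|z k| <= B) -> forall e, 0 < e ->
    \forall n \near ideal_filter J, forall nu,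
      `|pairing (A nu n) z| < M * B / 2 ^+ p + e.
Proof.
move=> hI hJ AM AE.
have FI := ideal_filter_filter hI; have FJ := ideal_filter_filter hJ.
elim=> [|p IH] z B z0 B0 zB e e0.
  (* The plain l1 bound suffices here; [e] only makes the inequality strict. *)
  apply: filterS AM => n nM nu; rewrite expr0 divr1.
  by apply: le_lt_trans (l1_le_pairing (nM nu) zB) _; rewrite ltrDl.
pose E1 := [set k | B / 2 < z k]; pose E2 := [set k | z k < - (B / 2)].
have large_I (E : set nat) : (forall k, E k -> B / 2 <= `|z k|) -> I E.
  move=> EB; have /cvgr0Pnorm_lt /(_ (B / 2)) := z0.
  move=> /(_ ltac:(lra)); apply: (ideal_subset hI) => k /= Ek.
  by rewrite ltNge; apply/negP; rewrite negbK; exact: EB.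
have IE1 : I E1.
  by apply: large_I => k /ltW zk; exact: le_trans zk (ler_norm _).
have IE2 : I E2.
  by apply: large_I => k; rewrite /E2 /= -normrN => zk;
    apply: le_trans (ler_norm _); lra.
pose z' : nat -> R := fun k => z k - B / 2 * \1_E1 k + B / 2 * \1_E2 k.
(* The first bound feeds the induction; the second keeps [z'] convergent to 0 along [I]. *)
have z'_le k : `|z' k| <= B / 2 /\ `|z' k| <= `|z k|.
  have i1 : \1_E1 k = ((B / 2 < z k)%R : bool)%:R :> R.
    rewrite indicE; congr ((nat_of_bool _)%:R).
    by apply/idP/idP => [/set_mem|/mem_set].
  have i2 : \1_E2 k = ((z k < - (B / 2))%R : bool)%:R :> R.
    rewrite indicE; congr ((nat_of_bool _)%:R).
    by apply/idP/idP => [/set_mem|/mem_set].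
  have := zB k; rewrite ler_norml => /andP[lo hi]; rewrite /z' i1 i2.
  case: (ltrP (B / 2) (z k)) => k1; case: (ltrP (z k) (- (B / 2))) => k2;
    rewrite ?mulr0 ?mulr1 ?subr0 ?addr0.
  - by exfalso; lra.
  - by rewrite !ger0_norm; [split|..]; lra.
  - by rewrite !ler0_norm; [split|..]; lra.
  - by rewrite lexx ler_norml k1 k2.
have zE : z = (fun k => (z' k + B / 2 * \1_E1 k) + (- (B / 2)) * \1_E2 k).
  by apply/funext => k; rewrite /z'; ring.
have ind1 (E : set nat) k : `|\1_E k : R| <= 1.
  by rewrite indicE; case: (_ \in _); rewrite ?normr0 ?normr1.
have z'B k : `|z' k + B / 2 * \1_E1 k| <= B.
  apply: le_trans (ler_normD _ _) _; rewrite normrM gtr0_norm; last by lra.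
  have [? _] := z'_le k.
  have : B / 2 * `|\1_E1 k : R| <= B / 2 by rewrite ler_piMr //; lra.
  by lra.
have z'0 : z' @ ideal_filter I --> 0.
  apply/cvgr0Pnorm_lt => d d0; have /cvgr0Pnorm_lt /(_ d d0) := z0.
  by apply: filterS => k; apply: le_lt_trans; case: (z'_le k).
(* Each indicator carries the coefficient [B / 2] and so costs less than [e / 4]; the induction
   hypothesis uses the other [e / 2]. *)
have e'0 : 0 < e / (2 * B) by rewrite divr_gt0 ?mulr_gt0.
have z'lt : \forall n \near ideal_filter J, forall nu,
    `|pairing (A nu n) z'| < M * (B / 2) / 2 ^+ p + e / 2.
  by apply: IH => //; [lra | move=> k; case: (z'_le k) | lra].
have ind_lt : \forall n \near ideal_filter J, forall nu,
    `|pairing (A nu n) \1_E1| < e / (2 * B) /\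
    `|pairing (A nu n) \1_E2| < e / (2 * B).
  move: (AE _ IE1 _ e'0) (AE _ IE2 _ e'0).
  by apply: filterS2 => n n1 n2 nu; split.
move: AM z'lt ind_lt; apply: filterS3 => n nM n' n12 nu.
have [n1 n2] := n12 nu; have {}n' := n' nu.
rewrite zE (pairing_lin _ (nM nu) z'B (ind1 _)).
rewrite (pairing_lin _ (nM nu) (fun k => (z'_le k).1) (ind1 _)).
have -> : M * B / 2 ^+ p.+1 = M * (B / 2) / 2 ^+ p.
  by rewrite exprS; field; rewrite expf_neq0.
have half_lt c : c < e / (2 * B) -> B / 2 * c < e / 4.
  by move=> ce; rewrite (_ : e / 4 = B / 2 * (e / (2 * B))) ?ltr_pM2l //;
    [lra | field; rewrite gt_eqF].
have := ler_normD (pairing (A nu n) z' + B / 2 * pairing (A nu n) \1_E1)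
  (- (B / 2) * pairing (A nu n) \1_E2).
have := ler_normD (pairing (A nu n) z') (B / 2 * pairing (A nu n) \1_E1).
have normM c : `|B / 2 * c| = B / 2 * `|c|.
  by rewrite normrM gtr0_norm //; lra.
rewrite mulNr normrN !normM.
by have := half_lt _ n1; have := half_lt _ n2; lra.
Qed.

(** * Test sequences and the characterization of regularity *)

(** Outside [E] the indicator equals its limit, so every exceptional set lies in [E]. *)
Lemma ideal_cvg_indic {R : realType} (I : set (set nat)) (E : set nat) :
  is_ideal I -> I E -> ideal_cvg I (\1_E : nat -> R) 0.
Proof.
move=> hI IE U /nbhs_singleton U0; apply: (ideal_subset hI) IE => k /= nU.
by apply: contrapT => nE; apply: nU; rewrite indicE memNset.
Qed.

Lemma pairing_indic {R : realType} (b : nat -> R) (E : set nat) :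
  pairing b \1_E = limn (fun m => \sum_(0 <= k < m | k \in E) b k).
Proof.
congr (limn _); apply/funext => m; rewrite /series /= [RHS]big_mkcond.
by apply: eq_bigr => k _; rewrite indicE; case: ifP; rewrite ?mulr1 ?mulr0.
Qed.

Lemma pairing1 {R : realType} (b : nat -> R) :
  pairing b (fun=> 1) = limn (series b).
Proof.
by congr (limn (series _)); apply/funext => k; rewrite mulr1.
Qed.

Theorem corollary2p5 (R : realType) (I J : set (set nat))
    (hI : is_ideal I) (hJ : is_ideal J) (hJc : countably_generated J)
    (K : Type) (hK : inhabited K) (A : K -> nat -> nat -> R) :
  regular_wrt_id I J A <->
  [/\ (* M1 *)
      forall nu : K,
        (ereal_sup [set row_abs_sum (A nu) n | n in [set: nat]] < +oo)%E,
      (* M2 *)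
      exists2 J0 : set nat, dual_filter J J0 &
        (ereal_sup [set ereal_sup [set row_abs_sum (A nu) n | n in J0]
                   | nu in [set: K]] < +oo)%E,
      (* M3 *)
      unif_ideal_cvg J (fun (nu : K) (n : nat) =>
        limn (series (A nu n))) 1 &
      (* M4 *)
      forall E : set nat, I E ->
        unif_ideal_cvg J (fun (nu : K) (n : nat) =>
          limn (fun m => \sum_(0 <= k < m | k \in E) A nu n k)) 0].
Proof.
have FI := ideal_filter_filter hI; have FJ := ideal_filter_filter hJ.
have [nu0] := hK.
split=> [[reg reglim]|[M1 [_ [J0 JJ0 <-] M2] M3 M4]].
- have bic1 : bounded_ideal_cvg I (fun=> 1 : R).
    split; last by exists 1; apply/ideal_cvgP; exact: cvg_cst.
    by apply: (bounded_seqP _).2; exists 1 => k; rewrite normr1.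
  have Al1 nu n : exists M, l1_le (A nu n) M.
    apply: l1_le_of_c0_cvg => x /(c0_bounded_ideal_cvg hI)[xI _].
    exact: (reg nu).1 x xI n.
  split.
  + move=> nu; have [||M AM] := @c0_uniform_boundedness R (A nu).
    * exact: Al1.
    * move=> x /(c0_bounded_ideal_cvg hI)[xI _].
      by have [/bounded_seqP] := (reg nu).2 x xI.
    apply/ereal_sup_ltyP; exists M => _ [n _ <-].
    exact/row_abs_sum_le.
  (* Regularity at a null sequence, with tolerance 1, supplies the pointwise bound. *)
  + have [x x0|M AM] := near_l1_le hJ hJc Al1.
      have [xI xI0] := c0_bounded_ideal_cvg hI x0.
      have /(unif_ideal_cvgP _ _ hJ) /(_ 1 ltr01) := reglim x xI 0 xI0.
      by apply: filterS => n xn nu; have := xn nu; rewrite subr0 => /ltW.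
    exists [set n | forall nu, l1_le (A nu n) M].
      by eexists; [exact: AM | rewrite setCK].
    apply/ereal_sup_ltyP; exists M => _ [nu _ <-].
    apply: ge_ereal_sup => _ [n nM <-].
    exact/row_abs_sum_le.
  + have := reglim _ bic1 1; rewrite (_ : (fun nu => _) =
        (fun nu n => limn (series (A nu n)))); last first.
      by apply/funext => nu; apply/funext => n; exact: pairing1.
    by apply; apply/ideal_cvgP; exact: cvg_cst.
  + move=> E IE; have E0 := ideal_cvg_indic (R := R) hI IE.
    have := reglim \1_E _ 0 E0; rewrite (_ : (fun nu => _) = (fun nu n =>
        limn (fun m => \sum_(0 <= k < m | k \in E) A nu n k))); last first.
      by apply/funext => nu; apply/funext => n; exact: pairing_indic.
    apply; split; last by exists 0.
    apply: (bounded_seqP _).2; exists 1 => k.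
    by rewrite indicE; case: (_ \in _); rewrite ?normr0 ?normr1.
have Al1 nu : exists M, forall n, l1_le (A nu n) M.
  have /ereal_sup_ltyP[M AM] := M1 nu; exists M => n.
  by apply/row_abs_sum_le; apply: AM; exists n.
have {M2}[M AM] : exists M,
    \forall n \near ideal_filter J, forall nu, l1_le (A nu n) M.
  have /ereal_sup_ltyP[M AM] := M2; exists M.
  apply: (@filterS _ _ FJ (~` J0)); last by rewrite /ideal_filter /= setCK.
  move=> n J0n nu; apply/row_abs_sum_le.
  apply: le_trans (AM _ _); last by exists nu.
  by apply: ereal_sup_ubound; exists n.
have null_indic E : I E -> forall e, 0 < e ->
    \forall n \near ideal_filter J, forall nu, `|pairing (A nu n) \1_E| < e.
  move=> IE e e0; have /(unif_ideal_cvgP _ _ hJ) /(_ e e0) := M4 E IE.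
  by apply: filterS => n nE nu; have := nE nu; rewrite subr0 pairing_indic.
have lim_unif x : bounded_ideal_cvg I x -> forall eta, ideal_cvg I x eta ->
    unif_ideal_cvg J (fun nu => mx_transform (A nu) x) eta.
  move=> [/bounded_seqP[B xB] _] eta /ideal_cvgP xeta.
  apply/(unif_ideal_cvgP _ _ hJ) => e e0.
  (* The summand 1 makes [C] positive. *)
  pose z k := x k - eta; pose C := B + `|eta| + 1.
  have zC k : `|z k| <= C.
    by apply: le_trans (ler_normB _ _) _; have := xB k; rewrite /C; lra.
  have C0 : 0 < C.
    by have := le_trans (normr_ge0 _) (xB 0%N); have := normr_ge0 eta;
      rewrite /C; lra.
  have z0 : z @ ideal_filter I --> 0.
    by rewrite -(subrr eta); apply: cvgB => //; exact: cvg_cst.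
  have e3 : 0 < e / 3 by lra.
  (* This tolerance for the row sums keeps [eta] times their deviation from 1 below [e / 3], also
     when [eta] is 0. *)
  have d0 : 0 < e / 3 / (`|eta| + 1).
    by rewrite divr_gt0 // ltr_wpDl.
  have [p MCp] : exists p : nat, M * C / 2 ^+ p < e / 3.
    have /cvgr0Pnorm_lt /(_ _ e3) := @cvg_geometric R (M * C) 2^-1
      ltac:(by rewrite ger0_norm ?invr_ge0 // invf_lt1 // ltr1n).
    case=> p _ /(_ p (leqnn p)) /=; exists p.
    by rewrite -exprVn; apply: le_lt_trans (ler_norm _) _.
  have /(unif_ideal_cvgP _ _ hJ) /(_ _ d0) := M3.
  have := near_pairing_null hI hJ AM null_indic p z0 C0 zC e3.
  (* Writing [x] as [z + eta] splits the error into three thirds: the halved bound, the slack for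
     [z], and the deviation of the row sum. *)
  apply: filterS2 => n nz n1 nu; have [M' AM'] := Al1 nu.
  have -> : x = (fun k => z k + eta * 1) by apply/funext => k; rewrite /z; ring.
  rewrite /mx_transform -/(pairing _ _).
  rewrite (@pairing_lin _ _ z (fun=> 1) _ _ 1 _ (AM' n) zC) => [|k]; last first.
    by rewrite normr1.
  rewrite pairing1 -addrA -[X in _ - X]mulr1 -mulrBr.
  apply: le_lt_trans (ler_normD _ _) _; rewrite normrM.
  have := n1 nu; rewrite ltr_pdivlMr ?ltr_wpDl // mulrC mulrDl mul1r.
  set s := `|_ - 1|; have : 0 <= s by exact: normr_ge0.
  by have := nz nu; lra.
split=> // nu; split=> [x [/bounded_seqP[B xB] _] n|x xI].
  by have [M' AM'] := Al1 nu; exact: l1_le_cvg (AM' n) xB.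
split.
  have [/bounded_seqP[B xB] _] := xI; have [M' AM'] := Al1 nu.
  apply: (bounded_seqP _).2; exists (M' * B) => n.
  exact: l1_le_pairing (AM' n) xB.
(* For a single [nu], the exceptional set is contained in the one provided by the uniform limit. *)
have [_ [eta xeta]] := xI; exists eta => U Ueta.
have [_ [S JS <-] SU] := lim_unif x xI eta xeta U Ueta.
apply: (ideal_subset hJ) JS => n /= nU.
by apply: contrapT => /SU /(_ nu).
Qed.
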